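(* (1) Every finitely generated left (resp. right) ideal of the algebra $\mathbb{I}_1$ is generated by two elements. (2) Let $I$ be a left (resp. right) ideal of $\mathbb{I}_1$. Then (a) if $I\not\subseteq F$ then the left (resp. right) ideal $I$ is generated by two elements; (b) if $I\subseteq F$ and $I$ is a finitely generated left (resp. right) ideal then $I$ is generated by a single element.
   Context: $K$ is a field of characteristic zero. $\mathbb{I}_1$ is the subalgebra of $\mathrm{End}_K(K[x])$ generated by (multiplication by) $x$, $\partial=\frac{d}{dx}$ and $\int: x^n\mapsto \frac{x^{n+1}}{n+1}$. Put $e_{ij}:=\int^i\partial^j-\int^{i+1}\partial^{j+1}$ ($i,j\ge0$) and $F:=\bigoplus_{i,j\ge0}Ke_{ij}$, an ideal of $\mathbb{I}_1$. *)

(* Defs.v *)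
From HB Require Import structures.
From mathcomp Require Import all_boot all_order all_algebra.
From mathcomp Require Import boolp classical_sets functions cardinality.

Set Implicit Arguments.
Unset Strict Implicit.
Unset Printing Implicit Defensive.

Import GRing.Theory.

Local Open Scope classical_set_scope.
Local Open Scope ring_scope.

Section OneSidedIdeals.
Variable R : pzRingType.
Implicit Types I G : set R.

(* Closure under opposites follows by taking a = -1. *)
Definition left_ideal I :=
  [/\ I 0, forall x y, I x -> I y -> I (x + y)
         & forall a x, I x -> I (a * x)].

Definition right_ideal I :=
  [/\ I 0, forall x y, I x -> I y -> I (x + y)
         & forall a x, I x -> I (x * a)].

Definition left_ideal_gen G : set R := smallest left_ideal G.
Definition right_ideal_gen G : set R := smallest right_ideal G.

Definition left_ideal_fg I := exists2 G, finite_set G & I = left_ideal_gen G.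
Definition right_ideal_fg I := exists2 G, finite_set G & I = right_ideal_gen G.

End OneSidedIdeals.

Definition poly_end (K : fieldType) := {linear {poly K} -> {poly K}}.

Section PolyEndAlgebra.
Variable K : fieldType.
Local Notation E := (poly_end K).
Implicit Types f g h : E.

HB.instance Definition _ := gen_eqMixin E.
HB.instance Definition _ := gen_choiceMixin E.

Lemma poly_endP f g : (f : {poly K} -> {poly K}) =1 g -> f = g.
Proof.
case: f g => [f [[fD] [fZ]]] [g [[gD] [gZ]]] /= /funext fg.
case: _ / fg in gD gZ *.
by rewrite (Prop_irrelevance fD gD) (Prop_irrelevance fZ gZ).
Qed.

Definition poly_end_zero : E := \0.
Definition poly_end_opp f : E := \- f.
Definition poly_end_add f g : E := f \+ g.
Definition poly_end_scale (a : K) f : E := a \*: f.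
Definition poly_end_one : E := idfun.
(* The product is composition, endomorphisms acting on the left. *)
Definition poly_end_mul f g : E := f \o g.

Fact poly_end_addA : associative poly_end_add.
Proof. by move=> f g h; apply: poly_endP => p /=; rewrite addrA. Qed.
Fact poly_end_addC : commutative poly_end_add.
Proof. by move=> f g; apply: poly_endP => p /=; rewrite addrC. Qed.
Fact poly_end_add0 : left_id poly_end_zero poly_end_add.
Proof. by move=> f; apply: poly_endP => p /=; rewrite add0r. Qed.
Fact poly_end_addN : left_inverse poly_end_zero poly_end_opp poly_end_add.
Proof. by move=> f; apply: poly_endP => p /=; rewrite addNr. Qed.

HB.instance Definition _ := GRing.isZmodule.Build E
  poly_end_addA poly_end_addC poly_end_add0 poly_end_addN.

Fact poly_end_mulA : associative poly_end_mul.
Proof. by move=> f g h; apply: poly_endP. Qed.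
Fact poly_end_mul1 : left_id poly_end_one poly_end_mul.
Proof. by move=> f; apply: poly_endP. Qed.
Fact poly_end_mulr1 : right_id poly_end_one poly_end_mul.
Proof. by move=> f; apply: poly_endP. Qed.
Fact poly_end_mulDl : left_distributive poly_end_mul +%R.
Proof. by move=> f g h; apply: poly_endP. Qed.
Fact poly_end_mulDr : right_distributive poly_end_mul +%R.
Proof. by move=> f g h; apply: poly_endP => p /=; rewrite linearD. Qed.
Fact poly_end_oner_neq0 : poly_end_one != 0.
Proof.
apply/eqP => /(congr1 (fun f : E => f 1)) /eqP /=.
by rewrite oner_eq0.
Qed.

HB.instance Definition _ := GRing.Zmodule_isNzRing.Build E
  poly_end_mulA poly_end_mul1 poly_end_mulr1 poly_end_mulDl poly_end_mulDr
  poly_end_oner_neq0.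

Fact poly_end_scaleA a b f :
  poly_end_scale a (poly_end_scale b f) = poly_end_scale (a * b) f.
Proof. by apply: poly_endP => p /=; rewrite scalerA. Qed.
Fact poly_end_scale1 : left_id 1 poly_end_scale.
Proof. by move=> f; apply: poly_endP => p /=; rewrite scale1r. Qed.
Fact poly_end_scaleDr : right_distributive poly_end_scale +%R.
Proof. by move=> a f g; apply: poly_endP => p /=; rewrite scalerDr. Qed.
Fact poly_end_scaleDl f : {morph poly_end_scale^~ f : a b / a + b}.
Proof. by move=> a b; apply: poly_endP => p /=; rewrite scalerDl. Qed.

HB.instance Definition _ := GRing.Zmodule_isLmodule.Build K E
  poly_end_scaleA poly_end_scale1 poly_end_scaleDr poly_end_scaleDl.

Fact poly_end_scaleAl (a : K) f g : a *: (f * g) = (a *: f) * g.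
Proof. by apply: poly_endP. Qed.

HB.instance Definition _ := GRing.Lmodule_isLalgebra.Build K E
  poly_end_scaleAl.

Fact poly_end_scaleAr (a : K) f g : a *: (f * g) = f * (a *: g).
Proof. by apply: poly_endP => p /=; rewrite linearZ. Qed.

HB.instance Definition _ := GRing.Lalgebra_isAlgebra.Build K E
  poly_end_scaleAr.

Lemma poly_end_mulE f g p : (f * g) p = f (g p).
Proof. by []. Qed.

End PolyEndAlgebra.

Section Generators.
Variable K : fieldType.

Definition mulX (p : {poly K}) : {poly K} := 'X * p.

Definition integ (p : {poly K}) : {poly K} :=
  \sum_(n < size p) (p`_n / n.+1%:R) *: 'X^(n.+1).

Fact mulX_is_linear : linear mulX.
Proof. by move=> a p q; rewrite /mulX mulrDr scalerAr. Qed.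

Lemma integE n (p : {poly K}) : (size p <= n)%N ->
  integ p = \sum_(i < n) (p`_i / i.+1%:R) *: 'X^(i.+1).
Proof.
move=> pn; rewrite /integ (big_ord_widen n
  (fun i => (p`_i / i.+1%:R) *: 'X^(i.+1))) // big_mkcond.
apply: eq_bigr => i _; case: ltnP => // pi.
by rewrite nth_default // mul0r scale0r.
Qed.

Fact integ_is_linear : linear integ.
Proof.
move=> a p q.
pose n := maxn (size (a *: p + q)) (maxn (size p) (size q)).
rewrite !(@integE n) ?leq_max ?leqnn ?orbT // scaler_sumr -big_split /=.
apply: eq_bigr => i _.
by rewrite coefD coefZ mulrDl scalerDl scalerA mulrA.
Qed.

Lemma integXn n : integ 'X^n = n.+1%:R^-1 *: 'X^(n.+1).
Proof.
rewrite /integ size_polyXn big_ord_recr /= big1 ?add0r => [|i _].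
  by rewrite coefXn eqxx mul1r.
by rewrite coefXn (ltn_eqF (ltn_ord i)) mul0r scale0r.
Qed.

HB.instance Definition _ := GRing.isLinear.Build K _ _ _ mulX mulX_is_linear.
HB.instance Definition _ := GRing.isLinear.Build K _ _ _ integ integ_is_linear.

Definition opX : poly_end K := mulX.
Definition opD : poly_end K := deriv.
Definition opJ : poly_end K := integ.

End Generators.

Section I1.
Variable K : fieldType.

Definition I1_set : set (poly_end K) :=
  smallest (fun B => GRing.subalg_closed [in B])
           [set opX K; opD K; opJ K].

Definition I1_pred : {pred poly_end K} := [in I1_set].

Record I1 := MkI1 { I1val : poly_end K; _ : I1val \in I1_pred }.

HB.instance Definition _ := [isSub for I1val].
HB.instance Definition _ := [Choice of I1 by <:].

Fact I1_subalg_closed : GRing.subalg_closed I1_pred.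
Proof.
split=> [|a f g|f g].
- by rewrite inE => B [[B1 _ _] _]; rewrite inE in B1.
- rewrite !inE => If Ig B [BE GB].
  have [_ /(_ a f g) Bl _] := BE.
  rewrite !inE in Bl; apply: Bl; [exact: If|exact: Ig].
- rewrite !inE => If Ig B [BE GB].
  have [_ _ /(_ f g) Bm] := BE.
  rewrite !inE in Bm; apply: Bm; [exact: If|exact: Ig].
Qed.

HB.instance Definition _ :=
  GRing.isSubalgClosed.Build K (poly_end K) I1_pred I1_subalg_closed.
HB.instance Definition _ := [SubChoice_isSubAlgebra of I1 by <:].

Fact opX_I1 : opX K \in I1_pred.
Proof. by rewrite inE; apply: sub_gen_smallest; left; left. Qed.
Fact opD_I1 : opD K \in I1_pred.
Proof. by rewrite inE; apply: sub_gen_smallest; left; right. Qed.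
Fact opJ_I1 : opJ K \in I1_pred.
Proof. by rewrite inE; apply: sub_gen_smallest; right. Qed.

Definition I1_X : I1 := MkI1 opX_I1.
Definition I1_D : I1 := MkI1 opD_I1.
Definition I1_J : I1 := MkI1 opJ_I1.

Definition I1_e (i j : nat) : I1 :=
  I1_J ^+ i * I1_D ^+ j - I1_J ^+ i.+1 * I1_D ^+ j.+1.

(* The K-span of the e_ij.  That the sum is direct is a property of the e_ij
   in characteristic zero and does not affect the underlying set. *)
Definition I1_F : set I1 :=
  [set f | exists n (c : 'M[K]_n),
     f = \sum_(i < n) \sum_(j < n) c i j *: I1_e i j].

End I1.

Arguments I1_set K : clear implicits.
Arguments I1_F K : clear implicits.

(* Main.v *)
From HB Require Import structures.
Require Import Defs.
From mathcomp Require Import all_boot all_order all_algebra.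
From mathcomp Require Import boolp classical_sets functions cardinality.

(** Write [J] for integration, [D] for derivation and [H] for [D * x], so that
    [x = J * H]. In the basis [x ^ n / n!] the operator [J] shifts up, [D]
    shifts down, [H] is diagonal with eigenvalues [n + 1], and [e0 = 1 - J * D]
    is the projection onto the constants. The whole argument uses only that [J],
    [D] and [H] generate the algebra and satisfy [D J = 1], [H J = J (H + 1)],
    [D H = (H + 1) D] and [e0 H = e0] ([integro_differential]). This
    presentation is stable under reversing the product and exchanging [J] with
    [D], so the statements on right ideals are those on left ideals of the
    opposite algebra.

    The ideal [F] consists of the operators killed by a power of [D] on the left
    ([finite_rank]), equivalently by a power of [J] on the right
    ([finite_rank_expJ] and [finite_rank_opposite]). Two facts reduce the study
    of a left ideal [I] to polynomials. First, every element becomes, after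
    multiplication on the left by a power of [D], a skew polynomial
    [sum_i c_i(H) D^i] ([expD_normal]), and [x - J^k D^k x] lies in [F]. Second,
    an element [f] of [F] is determined, as far as membership in left ideals is
    concerned, by its rows [e0 D^i f], and each of these has the form [e0 q(D)]
    with [q] a polynomial ([vacuum_mul], [finite_rank_mem]); so the intersection
    of [I] and [F] is encoded by a linear subspace of [K[X]].

    The device that saves generators is [stack]: the element
    [J^n a + sum_(i < n) J^i e0 w_i(D)] generates the same left ideal as [a]
    together with the [n] rows [e0 w_i(D)], because multiplication by [D^n],
    resp. by [e0 D^i], recovers each of them. A finitely generated left ideal
    inside [F] involves only polynomials of bounded degree, that is finitely
    many rows, and so is principal ([left_finite_rank_principal]).

    If [I] is not contained in [F], then the skew polynomials in [I] form a
    nonzero left ideal [L] of [K[H][D]]. By Hilbert's basis argument it is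
    finitely generated ([skew_ideal_fg]), and for [a] of minimal degree in [L]
    each generator is torsion modulo [a], that is, a nonzero [p(H)] multiplies
    it into the left ideal of [a] ([skew_ideal_torsion]). Two torsion elements
    [x], [y] killed by [p(H)] and [q(H)] can be replaced by the single element
    [x + D^i y]: in characteristic zero some [i] makes [p(X - i)] and [q]
    coprime ([coprime_shift]), and Bezout's identity separates the two summands
    ([torsion_merge]). Hence modulo [F] the ideal [I] is generated by [a] and
    one further element. Finally the rows coming from [a] realise all large
    degrees ([size_vrow_expD]), so only finitely many rows of [I] are missing,
    and these are stacked onto [a], which costs no further generator. *)

Set Implicit Arguments.
Unset Strict Implicit.
Unset Printing Implicit Defensive.

Import GRing.Theory.

Local Open Scope classical_set_scope.
Local Open Scope ring_scope.

(** * Polynomials in characteristic zero *)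

Section Shifts.
Variable K : fieldType.
Hypothesis charK0 : [pchar K] =i pred0.
Implicit Types p q : {poly K}.

Lemma natr_inj_pchar0 : injective (fun n => n%:R : K).
Proof.
have le m n : (m <= n)%N -> m%:R = n%:R :> K -> m = n.
  move=> mn /esym /eqP; rewrite -subr_eq0 -natrB // (pcharf0P _).1 // subn_eq0.
  by move=> nm; apply/eqP; rewrite eqn_leq mn.
move=> m n eq_mn; have [/le|/ltnW/le] := leqP m n; first exact.
by move=> le_nm; rewrite le_nm.
Qed.

Lemma eventually_nonroot p : p != 0 ->
  exists N, forall n, (N <= n)%N -> p.[n%:R] != 0.
Proof.
move=> p0; apply: contrapT => /forallNP noN.
have {noN}rootN N : exists2 n, (N <= n)%N & root p n%:R.
  apply: contrapT => noR; apply: (noN N) => n Nn; apply/negP => pn.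
  by apply: noR; exists n.
have : exists rs : seq nat, [/\ uniq rs, all (root p) [seq n%:R | n <- rs]
    & size rs = size p].
  elim: (size p) => [|m [rs [Urs Rrs srs]]]; first by exists [::].
  have [n rsn pn] := rootN (\max_(i <- rs) i).+1.
  exists (n :: rs); split=> /=; rewrite ?srs ?pn ?Urs ?andbT //.
  apply/negP => nrs; move: rsn; rewrite ltnNge => /negP; apply.
  exact: leq_bigmax_seq.
case=> rs [Urs Rrs srs].
have := max_poly_roots p0 Rrs.
by rewrite (map_inj_uniq natr_inj_pchar0) size_map srs ltnn => /(_ Urs).
Qed.

(** The resultant of [p(X + t)] and [q], a polynomial in [t], is nonzero and
    lies in the ideal generated by these two polynomials. Specialising [t] to a
    negative integer that is not a root gives a Bezout identity. *)
Lemma coprime_shift p q : p != 0 -> q != 0 ->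
  exists i, coprimep (p \Po ('X - i%:R%:P)) q.
Proof.
move=> p0 q0; have [p1|p1] := leqP (size p) 1.
  exists 0%N; rewrite (size1_polyC p1) comp_polyC; apply/Bezout_coprimepP.
  exists (1, 0); rewrite mul1r mul0r addr0 polyC_eqp1.
  by apply: contraNneq p0 => p00; rewrite (size1_polyC p1) p00.
have [q1|q1] := leqP (size q) 1.
  exists 0%N; rewrite (size1_polyC q1); apply/Bezout_coprimepP.
  exists (0, 1); rewrite mul1r mul0r add0r polyC_eqp1.
  by apply: contraNneq q0 => q00; rewrite (size1_polyC q1) q00.
have r0 := sub_annihilant_neq0 p0 q0; set r := sub_annihilant p q in r0.
have r'0 : r \Po - 'X != 0.
  rewrite -size_poly_eq0 size_comp_poly2 ?size_polyN ?size_polyX //.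
  by rewrite size_poly_eq0.
(* Choose [N] such that [- N] is not a root of the resultant. *)
have [N /(_ N (leqnn N))] := eventually_nonroot r'0.
rewrite horner_comp hornerN hornerX => rN.
exists N; apply/Bezout_coprimepP.
have [|| [u v] /= _] := @resultant_in_ideal _ (poly_XaY p) (map_poly polyC q).
- by rewrite size_poly_XaY.
- by rewrite size_map_polyC.
pose ev : {rmorphism {poly {poly K}} -> {poly K}} :=
  map_poly (horner_eval (- N%:R : K)).
have evC s : ev (map_poly polyC s) = s.
  by apply/polyP => i; rewrite !coef_map /= /horner_eval hornerC.
have ev_shift : ev (poly_XaY p) = p \Po ('X - N%:R%:P).
  rewrite /poly_XaY /ev /= map_comp_poly -[map_poly _ (map_poly _ _)]/(ev _).
  rewrite evC.
  by rewrite rmorphD /= map_polyX map_polyC /= /horner_eval hornerX polyCN.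
move=> /(congr1 ev); rewrite rmorphD !rmorphM evC ev_shift => bez.
exists (ev u, ev v); rewrite -[u in u %= 1]bez /ev /= map_polyC polyC_eqp1.
exact: rN.
Qed.

End Shifts.

(** * Linear subsets *)

Definition linear_set (R : pzRingType) (V : lmodType R) (M : set V) :=
  M 0 /\ forall a x y, M x -> M y -> M (a *: x + y).

Lemma linear_setZ (R : pzRingType) (V : lmodType R) (M : set V) a x :
  linear_set M -> M x -> M (a *: x).
Proof. by move=> [M0 Ml] Mx; rewrite -[_ *: _]addr0; apply: Ml. Qed.

Lemma linear_setB (R : pzRingType) (V : lmodType R) (M : set V) a x y :
  linear_set M -> M x -> M y -> M (x - a *: y).
Proof. by move=> [M0 Ml] Mx My; rewrite addrC -scaleNr; apply: Ml. Qed.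

Lemma minimize (T : Type) (P : set T) (f : T -> nat) x : P x ->
  exists2 y, P y & forall z, P z -> (f y <= f z)%N.
Proof.
move=> Px; have ex : exists n, `[< exists2 y, P y & f y = n >].
  by exists (f x); apply/asboolP; exists x.
case: (ex_minnP ex) => n /asboolP[y Py <-] minn.
by exists y => // z Pz; apply: minn; apply/asboolP; exists z.
Qed.

Lemma size_leading_cancel (R : nzRingType) (c d : R) (p q : {poly R}) :
    p != 0 -> size q = size p -> c * lead_coef p = d * lead_coef q ->
  (size (c *: p - d *: q)%R < size p)%N.
Proof.
rewrite -size_poly_gt0 => p0 qp; rewrite !lead_coefE qp => cd.
rewrite -(prednK p0) ltnS; apply/leq_sizeP => j; rewrite leq_eqVlt.
case/predU1P => [<-|jp]; rewrite coefB !coefZ ?cd ?subrr //.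
rewrite prednK // in jp.
by rewrite !nth_default ?mulr0 ?subr0 ?qp.
Qed.

(** A subspace of [K[X]] is spanned by one element for each degree that occurs
    in it. *)
Lemma linear_set_sizes (K : fieldType) (W U : set {poly K}) :
  linear_set W -> linear_set U ->
  (forall p, W p -> p != 0 -> exists q, [/\ W q, U q & size q = size p]) ->
  W `<=` U.
Proof.
move=> Wl Ul piv p; have [n] := ubnP (size p).
elim: n p => // n IHn p pn Wp; have [->|p0] := eqVneq p 0; first exact: Ul.1.
have [q [Wq Uq qp]] := piv p Wp p0.
have q0 : q != 0 by rewrite -size_poly_eq0 qp size_poly_eq0.
pose a := lead_coef p / lead_coef q.
have sz : (size (p - a *: q)%R < size p)%N.
  rewrite -{1}[p]scale1r; apply: size_leading_cancel => //.
  by rewrite mul1r divfK // lead_coef_eq0.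
rewrite -(subrK (a *: q) p) addrC.
apply: Ul.2 => //; apply: IHn.
  exact: leq_trans sz _.
exact: linear_setB.
Qed.

(** * Left ideals of the skew polynomial ring *)

Section SkewIdeals.
Variable K : fieldType.
Implicit Types (p q : {poly K}) (s a b g : {poly {poly K}}).

(** An element [s] of [K[X][Y]] stands for the skew polynomial
    [sum_i s_i(H) D^i]; since [D H = (H + 1) D], left multiplication by [D]
    becomes the following map. *)
Definition skew_shift s : {poly {poly K}} :=
  map_poly (comp_poly ('X + 1)) s * 'X.

Definition skew_ideal (L : set {poly {poly K}}) :=
  linear_set L /\ forall s, L s -> L (skew_shift s).

Lemma skew_ideal_iter L n s : skew_ideal L -> L s -> L (iter n skew_shift s).
Proof. by move=> [_ LS] Ls; elim: n => //= n; apply: LS. Qed.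

Let size_X1 : size ('X + 1 : {poly K}) = 2.
Proof. exact: size_XaddC. Qed.

Let tau0 : comp_poly ('X + 1) 0 = 0 :> {poly K}.
Proof. exact: comp_poly0. Qed.

Let tau_inj : injective (comp_poly ('X + 1 : {poly K})).
Proof.
move=> p q /eqP; rewrite -subr_eq0 -raddfB -size_poly_eq0 /=.
by rewrite size_comp_poly2 // size_poly_eq0 subr_eq0 => /eqP.
Qed.

Lemma lead_coef_skew_shift s :
  lead_coef (skew_shift s) = lead_coef s \Po ('X + 1).
Proof. by rewrite lead_coefMX (lead_coef_map_inj tau_inj tau0). Qed.

Lemma size_skew_shift s : s != 0 -> size (skew_shift s) = (size s).+1.
Proof.
move=> s0; rewrite size_mulX; first by rewrite (size_map_inj_poly tau_inj).
by rewrite -size_poly_eq0 (size_map_inj_poly tau_inj) // size_poly_eq0.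
Qed.

Lemma skew_shift_neq0 s : s != 0 -> skew_shift s != 0.
Proof. by move=> s0; rewrite -size_poly_eq0 size_skew_shift. Qed.

Lemma iter_skew_shift n s (t := iter n skew_shift s) : s != 0 ->
  [/\ t != 0, size t = (n + size s)%N &
      size (lead_coef t) = size (lead_coef s)].
Proof.
move=> s0; rewrite {}/t; elim: n => //= n [t0 st lt].
by rewrite skew_shift_neq0 // size_skew_shift // st lead_coef_skew_shift
  size_comp_poly2.
Qed.

Lemma lead_coef_iter_skew_shift n s :
  lead_coef (iter n skew_shift s) = lead_coef s \Po ('X + n%:R%:P).
Proof.
elim: n => [|n IHn]; first by rewrite addr0 comp_polyXr.
rewrite /= lead_coef_skew_shift IHn -comp_polyA comp_polyD comp_polyX.
by rewrite comp_polyC mulrS polyCD polyC1 addrA.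
Qed.

(** The leading coefficient of [b] can be divided with remainder by that of [g];
    a nonzero remainder would contradict the minimality of [g]. *)
Lemma skew_reduce (L : set {poly {poly K}}) g b :
    linear_set L -> L g -> L b -> g != 0 -> size b = size g ->
    (forall c, L c -> size c = size g ->
       (size (lead_coef g) <= size (lead_coef c))%N) ->
  exists q, (size (b - q *: g)%R < size b)%N.
Proof.
move=> Ll Lg Lb g0 bg ming; set n := (size g).-1.
have sg : size g = n.+1 by rewrite prednK // size_poly_gt0.
exists (lead_coef b %/ lead_coef g); set c := b - _.
have Lc : L c by apply: linear_setB.
have cn : c`_n = lead_coef b %% lead_coef g.
  rewrite coefB coefZ !lead_coefE bg -/n.
  by rewrite {1}[b`_n](divp_eq _ g`_n) addrAC subrr add0r.
have sc : (size c <= n.+1)%N.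
  rewrite (leq_trans (size_polyD _ _)) // geq_max bg sg leqnn size_polyN /=.
  by rewrite (leq_trans (size_scale_leq _ _)) ?sg.
rewrite bg sg ltn_neqAle sc andbT; apply/eqP => scn.
have := ming c Lc (etrans scn (esym sg)).
rewrite [lead_coef c]lead_coefE scn /= cn leqNgt => /negP; apply.
by rewrite ltn_modp lead_coef_eq0.
Qed.

(** Hilbert's basis argument. Shifting preserves the degree of the leading
    coefficient, so an element [g] whose leading coefficient has the least
    degree in all of [L] reduces every element of at least its size. Below that
    size one generator for each size is enough. *)
Lemma skew_ideal_fg (L : set {poly {poly K}}) : skew_ideal L ->
  exists2 gs : seq {poly {poly K}}, (forall g, g \in gs -> L g) &
    forall M, skew_ideal M -> (forall g, g \in gs -> M g) -> L `<=` M.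
Proof.
move=> skL; have [Ll LS] := skL.
have [[f Lf f0]|L0] := pselect (exists2 f, L f & f != 0); last first.
  exists [::] => // M [[M0 _] _] _ s Ls; have [->//|s0] := eqVneq s 0.
  by case: L0; exists s.
have [g [Lg g0] ming] := @minimize _ [set s | L s /\ s != 0]
  (fun s => size (lead_coef s)) f (conj Lf f0).
have low n : exists x, L x /\ forall b, L b -> size b = n ->
    size x = n /\ (size (lead_coef x) <= size (lead_coef b))%N.
  have [[b Lb bn]|noL] := pselect (exists2 b, L b & size b = n); last first.
    by exists 0; split=> [|b Lb bn]; [exact: Ll.1 | case: noL; exists b].
  have [x [Lx xn] minx] := @minimize _ [set s | L s /\ size s = n]
    (fun s => size (lead_coef s)) b (conj Lb bn).
  by exists x; split=> // c Lc cn; split=> //; apply: minx.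
have [x Lx] := choice low.
exists (g :: [seq x n | n <- iota 0 (size g)]) => [h|M skM Mg].
  by rewrite inE => /predU1P[->//|/mapP[n _ ->]]; case: (Lx n).
have [Ml MS] := skM.
move=> b; have [n] := ubnP (size b); elim: n b => // n IHn b bn Lb.
have [->|b0] := eqVneq b 0; first exact: Ml.1.
suff [h [Lh Mh h0 bh minh]] : exists h, [/\ L h, M h, h != 0, size b = size h &
    forall c, L c -> size c = size h ->
      (size (lead_coef h) <= size (lead_coef c))%N].
  have [q ltb] := skew_reduce Ll Lh Lb h0 bh minh.
  rewrite -(subrK (q *: h) b) addrC; apply: Ml.2 => //; apply: IHn.
    exact: leq_trans ltb _.
  exact: linear_setB.
have [gb|bg] := leqP (size g) (size b).
  pose k := (size b - size g)%N.
  have [h0 sh lh] := iter_skew_shift k g0.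
  exists (iter k (@skew_shift) g); rewrite lh h0 sh subnK //; split=> //.
  - exact: skew_ideal_iter.
  - by apply: skew_ideal_iter => //; apply: Mg; rewrite inE eqxx.
  - move=> c Lc cb; apply: ming; split=> //.
    by rewrite -size_poly_eq0 cb size_poly_eq0.
have [Lxb /(_ b Lb erefl)[sxb _]] := Lx (size b).
exists (x (size b)); rewrite sxb; split=> //.
- by apply: Mg; rewrite inE map_f ?orbT // mem_iota.
- by rewrite -size_poly_eq0 sxb size_poly_eq0.
- by move=> c Lc cb; case: (Lx (size b)) => _ /(_ c Lc cb)[].
Qed.

(** Pseudo-division by the shifts of [a] ends with a remainder smaller than [a],
    hence zero. *)
Lemma skew_ideal_torsion (L M : set {poly {poly K}}) a :
    skew_ideal L -> skew_ideal M -> L a -> M a -> a != 0 ->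
    (forall b, L b -> b != 0 -> (size a <= size b)%N) ->
  forall b, L b -> exists2 p, p != 0 & M (p *: b).
Proof.
move=> skL skM La Ma a0 mina b; have [n] := ubnP (size b).
have [Ll LS] := skL; have [Ml MS] := skM.
elim: n b => // n IHn b bn Lb; have [->|b0] := eqVneq b 0.
  by exists 1; [exact: oner_neq0 | rewrite scaler0; exact: Ml.1].
pose k := (size b - size a)%N; have [] := iter_skew_shift k a0.
have Mh : M (iter k (@skew_shift) a) by apply: skew_ideal_iter.
have Lh : L (iter k (@skew_shift) a) by apply: skew_ideal_iter.
move: (iter _ _ _) Mh Lh => h Mh Lh h0; rewrite subnK ?mina // => hb _.
have lt_b : (size (lead_coef h *: b - lead_coef b *: h)%R < size b)%N.
  by apply: size_leading_cancel; rewrite // mulrC.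
have [||p p0 Mp] := IHn (lead_coef h *: b - lead_coef b *: h).
- exact: leq_trans lt_b _.
- by apply: linear_setB => //; apply: linear_setZ.
exists (p * lead_coef h); first by rewrite mulf_neq0 // lead_coef_eq0.
have := Ml.2 (p * lead_coef b) _ _ Mh Mp.
by rewrite scalerBr !scalerA addrC subrK.
Qed.

End SkewIdeals.

(** * One-sided ideals *)

Section LeftIdeals.
Variable R : pzRingType.
Implicit Types I G T : set R.

Lemma left_ideal_gen_ideal G : left_ideal (left_ideal_gen G).
Proof.
split=> [T [[T0 _ _] _] //|x y Gx Gy T TG|a x Gx T TG].
  by have [[_ TD _] _] := TG; apply: TD; [apply: Gx|apply: Gy].
by have [[_ _ TM] _] := TG; apply: TM; apply: Gx.
Qed.

Lemma left_ideal_genE I G : left_ideal I -> G `<=` I ->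
  (forall T, left_ideal T -> G `<=` T -> I `<=` T) -> I = left_ideal_gen G.
Proof.
move=> lI GI minI; apply/seteqP; split=> [|x]; last exact.
exact: minI (left_ideal_gen_ideal G) (@sub_gen_smallest _ _ _).
Qed.

Lemma left_idealB I x y : left_ideal I -> I x -> I y -> I (x - y).
Proof.
by move=> [_ ID IM] Ix Iy; rewrite -mulN1r; apply: ID => //; apply: IM.
Qed.

Lemma left_ideal_sum I n (x : nat -> R) : left_ideal I ->
  (forall i, (i < n)%N -> I (x i)) -> I (\sum_(i < n) x i).
Proof. by move=> [I0 ID _] Ix; apply: big_ind => // i _; apply: Ix. Qed.

End LeftIdeals.

(** * Normal forms in the algebra of integro-differential operators *)

(** [H] stands for [D] composed with multiplication by [x], and [1 - J * D] for
    evaluation at [0]. *)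
Record integro_differential (K : fieldType) (A : algType K) (J D H : A) := {
  idD_J : D * J = 1;
  idH_J : H * J = J * (H + 1);
  idD_H : D * H = (H + 1) * D;
  idproj_H : (1 - J * D) * H = 1 - J * D;
  id_gen : forall B : set A, B 1 ->
    (forall (c : K) x y, B x -> B y -> B (c *: x + y)) ->
    (forall x y, B x -> B y -> B (x * y)) ->
    B J -> B D -> B H -> forall x, B x }.

Section NormalForms.
Variables (K : fieldType) (A : algType K) (J D H : A).
Hypothesis idA : integro_differential J D H.
Implicit Types (p q c : {poly K}) (s t : {poly {poly K}}) (x y f : A).

Let DJ := idD_J idA.

(** The projection onto the constants, the states annihilated by [D]. *)
Definition vacuum : A := 1 - J * D.
Local Notation e0 := vacuum.

(** For operators on polynomials: the range has bounded degree. This is the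
    ideal [F]. *)
Definition finite_rank : set A := [set f | exists k, D ^+ k * f = 0].

Lemma vacuum_J : e0 * J = 0.
Proof. by rewrite mulrBl mul1r -mulrA DJ mulr1 subrr. Qed.

Lemma D_vacuum : D * e0 = 0.
Proof. by rewrite mulrBr mulr1 mulrA DJ mul1r subrr. Qed.

Lemma H_vacuum : H * e0 = e0.
Proof.
rewrite -[RHS](idproj_H idA) mulrBr mulrBl mulr1 mul1r mulrA (idH_J idA).
by rewrite -!mulrA (idD_H idA).
Qed.

Lemma vacuum_idem : e0 * e0 = e0.
Proof. by rewrite {2}/e0 mulrBr mulr1 mulrA vacuum_J mul0r subr0. Qed.

Lemma expD_expJ n : D ^+ n * J ^+ n = 1.
Proof.
elim: n => [|n IHn]; first by rewrite !expr0 mulr1.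
by rewrite exprSr exprS mulrA -(mulrA _ D) DJ mulr1.
Qed.

Lemma expD_expJ_vacuum m n : (n < m)%N -> D ^+ m * J ^+ n * e0 = 0.
Proof.
move=> nm; rewrite -(subnK nm) addnS -addSn exprD -!mulrA.
by rewrite (mulrA (D ^+ n)) expD_expJ mul1r exprSr -mulrA D_vacuum mulr0.
Qed.

Lemma vacuum_expD_expJ m n : (n < m)%N -> e0 * D ^+ n * J ^+ m = 0.
Proof.
move=> nm; rewrite -(subnKC nm) addSnnS exprD -mulrA (mulrA (D ^+ n)) expD_expJ.
by rewrite mul1r exprS mulrA vacuum_J mul0r.
Qed.

Lemma sub1_expJ_expD k :
  1 - J ^+ k * D ^+ k = \sum_(i < k) J ^+ i * e0 * D ^+ i.
Proof.
elim: k => [|k IHk]; first by rewrite big_ord0 !expr0 mulr1 subrr.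
rewrite big_ord_recr /= -IHk mulrBr mulrBl mulr1 addrA subrK mulrA -exprSr.
by rewrite -mulrA -exprS.
Qed.

(** Evaluation of skew polynomials, with coefficients on the left. *)
Definition skew_eval s : A := (map_poly (horner_alg H) s).[D].

Lemma skew_evalC c : skew_eval c%:P = horner_alg H c.
Proof. by rewrite /skew_eval map_polyC hornerC. Qed.

Lemma skew_evalMX s : skew_eval (s * 'X) = skew_eval s * D.
Proof. by rewrite /skew_eval rmorphM /= map_polyX hornerMX. Qed.

Lemma skew_evalZD c s t :
  skew_eval (c *: s + t) = horner_alg H c * skew_eval s + skew_eval t.
Proof. by rewrite /skew_eval rmorphD /= map_polyZ hornerD hornerZ. Qed.

Lemma skew_evalD s t : skew_eval (s + t) = skew_eval s + skew_eval t.
Proof. by rewrite /skew_eval rmorphD hornerD. Qed.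

Lemma skew_eval0 : skew_eval 0 = 0.
Proof. by rewrite /skew_eval rmorph0 horner0. Qed.

Lemma horner_algMXaddC x p (c : K) :
  horner_alg x (p * 'X + c%:P) = horner_alg x p * x + c%:A.
Proof. by rewrite rmorphD rmorphM /= horner_algX horner_algC. Qed.

Lemma D_polyH p : D * horner_alg H p = horner_alg H (p \Po ('X + 1)) * D.
Proof.
elim/poly_ind: p => [|p c IHp].
  by rewrite comp_poly0 !rmorph0 mulr0 mul0r.
rewrite horner_algMXaddC comp_polyD comp_polyM comp_polyX comp_polyC.
rewrite rmorphD rmorphM rmorphD /= horner_algX rmorph1 horner_algC.
by rewrite mulrDr mulrA IHp -mulrA (idD_H idA) mulrA mulrDl comm_alg.
Qed.

Lemma expD_polyH n p :
  D ^+ n * horner_alg H p = horner_alg H (p \Po ('X + n%:R%:P)) * D ^+ n.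
Proof.
elim: n p => [|n IHn] p; first by rewrite !expr0 addr0 comp_polyXr mul1r mulr1.
rewrite exprSr -mulrA D_polyH mulrA IHn -mulrA -exprSr -comp_polyA.
by rewrite comp_polyD comp_polyX comp_polyC mulrS polyCD polyC1 addrA addrAC.
Qed.

Lemma D_skew_eval s : D * skew_eval s = skew_eval (skew_shift s).
Proof.
elim/poly_ind: s => [|s c IHs].
  by rewrite /skew_shift rmorph0 mul0r skew_eval0 mulr0.
rewrite /skew_shift in IHs *.
rewrite skew_evalD skew_evalMX skew_evalC mulrDr mulrA IHs D_polyH.
rewrite rmorphD rmorphM /=.
rewrite map_polyX map_polyC /= !skew_evalMX skew_evalD skew_evalMX.
by rewrite skew_evalC mulrDl.
Qed.

Lemma expD_skew_eval n s :
  D ^+ n * skew_eval s = skew_eval (iter n (@skew_shift K) s).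
Proof.
elim: n => [|n IHn]; first by rewrite expr0 mul1r.
by rewrite exprS -mulrA IHn D_skew_eval.
Qed.

Lemma skew_eval_H s : exists t, skew_eval s * H = skew_eval t.
Proof.
elim/poly_ind: s => [|s c [t IHs]]; first by exists 0; rewrite skew_eval0 mul0r.
exists ((t + s) * 'X + (c * 'X)%:P).
rewrite !skew_evalD !skew_evalMX !skew_evalC skew_evalD rmorphM /= horner_algX.
rewrite mulrDl; congr (_ + _).
by rewrite -mulrA (idD_H idA) mulrA mulrDr mulr1 IHs.
Qed.

Lemma D_skew_eval_J s : exists t, D * skew_eval s * J = skew_eval t.
Proof.
elim/poly_ind: s => [|s c _]; first by exists 0; rewrite skew_eval0 mulr0 mul0r.
exists (skew_shift s + (c \Po ('X + 1))%:P).
rewrite !skew_evalD skew_evalMX !skew_evalC mulrDr mulrDl; congr (_ + _).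
  by rewrite mulrA D_skew_eval -mulrA DJ mulr1.
by rewrite D_polyH -mulrA DJ mulr1.
Qed.

(** The elements [x] such that for every skew polynomial [s] some [D^k s x] is a
    skew polynomial form a subalgebra containing the generators; it contains
    [J] because [D c(H) J = c(H + 1)]. *)
Lemma expD_normal x : exists k s, D ^+ k * x = skew_eval s.
Proof.
suff [k [s]] : exists k s, D ^+ k * (skew_eval 1 * x) = skew_eval s.
  by rewrite -polyC1 skew_evalC rmorph1 mul1r; exists k, s.
pose B : set A :=
  [set x | forall s, exists k t, D ^+ k * (skew_eval s * x) = skew_eval t].
apply: (id_gen idA (B := B)) => /=.
- by move=> s; exists 0%N, s; rewrite expr0 mul1r mulr1.
- move=> c y z By Bz s; have [k [t yt]] := By s; have [l [u zu]] := Bz s.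
  exists (k + l)%N.
  exists (c%:P *: iter l (@skew_shift K) t + iter k (@skew_shift K) u).
  rewrite skew_evalZD -!expD_skew_eval -yt -zu horner_algC mulr_algl !mulrDr.
  by rewrite -!scalerAr !(mulrA (D ^+ _) (D ^+ _)) -!exprD (addnC l).
- move=> y z By Bz s; have [k [t yt]] := By s; have [l [u zu]] := Bz t.
  by exists (l + k)%N, u; rewrite -zu -yt exprD !mulrA.
- move=> s; have [t st] := D_skew_eval_J s.
  by exists 1%N, t; rewrite mulrA expr1.
- by move=> s; exists 0%N, (s * 'X); rewrite expr0 mul1r skew_evalMX.
- by move=> s; have [t st] := skew_eval_H s; exists 0%N, t; rewrite expr0 mul1r.
Qed.

Lemma vacuum_polyH p : e0 * horner_alg H p = p.[1] *: e0.
Proof.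
elim/poly_ind: p => [|p c IHp]; first by rewrite rmorph0 mulr0 horner0 scale0r.
rewrite horner_algMXaddC mulrDr mulrA IHp -scalerAl (idproj_H idA).
by rewrite mulr_algr -scalerDl !hornerE.
Qed.

(** The row vector with entries the coefficients of [p], read as an operator
    with values in the constants. *)
Definition vrow p : A := e0 * horner_alg D p.

Lemma vrowZD (c : K) p q : vrow (c *: p + q) = c *: vrow p + vrow q.
Proof. by rewrite /vrow linearP /= mulr_algl mulrDr scalerAr. Qed.

Lemma vrowM p q : vrow (p * q) = vrow p * horner_alg D q.
Proof. by rewrite /vrow rmorphM mulrA. Qed.

Lemma vrowD p q : vrow (p + q) = vrow p + vrow q.
Proof. by rewrite /vrow rmorphD mulrDr. Qed.

Lemma vrowMX p : vrow (p * 'X) = vrow p * D.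
Proof. by rewrite vrowM horner_algX. Qed.

Lemma vrowC (c : K) : vrow c%:P = c *: e0.
Proof. by rewrite /vrow horner_algC mulr_algr. Qed.

Lemma vrow0 : vrow 0 = 0.
Proof. by rewrite /vrow rmorph0 mulr0. Qed.

Lemma vrow_D p : exists q, vrow p * D = vrow q.
Proof. by exists (p * 'X); rewrite vrowMX. Qed.

Lemma vrow_J p : exists q, vrow p * J = vrow q.
Proof.
elim/poly_ind: p => [|p c _]; first by exists 0; rewrite vrow0 mul0r.
exists p; rewrite vrowD vrowMX vrowC mulrDl -mulrA DJ mulr1.
by rewrite -scalerAl vacuum_J scaler0 addr0.
Qed.

Lemma vrow_H p : exists q, vrow p * H = vrow q.
Proof.
elim/poly_ind: p => [|p c [q IHp]]; first by exists 0; rewrite vrow0 mul0r.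
exists ((q + p) * 'X + c%:P).
rewrite !vrowD !vrowMX vrowD !vrowC mulrDl -mulrA (idD_H idA) mulrA.
rewrite mulrDr mulr1.
by rewrite IHp -scalerAl (idproj_H idA).
Qed.

(** The rows [e0 p(D)] form a right ideal, since they are stable under the
    generators: [D] multiplies [p] by [X], [J] deletes its constant term and [H]
    scales its coefficients. *)
Lemma vacuum_mul x : exists q, e0 * x = vrow q.
Proof.
suff [q] : exists q, vrow 1 * x = vrow q.
  by rewrite -polyC1 vrowC scale1r; exists q.
pose B : set A := [set x | forall p, exists q, vrow p * x = vrow q].
apply: (id_gen idA (B := B)) => //=.
- by move=> p; exists p; rewrite mulr1.
- move=> c y z By Bz p; have [q yq] := By p; have [r zr] := Bz p.
  by exists (c *: q + r); rewrite vrowZD -yq -zr mulrDr scalerAr.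
- move=> y z By Bz p; have [q yq] := By p; have [r zr] := Bz q.
  by exists r; rewrite -zr -yq mulrA.
- exact: vrow_J.
- exact: vrow_D.
- exact: vrow_H.
Qed.

Lemma vrow_expJ n p : (size p <= n)%N -> vrow p * J ^+ n = 0.
Proof.
elim: n p => [|n IHn] p.
  by rewrite leqn0 size_poly_eq0 => /eqP ->; rewrite vrow0 mul0r.
elim/poly_ind: p => [|p c _]; first by rewrite vrow0 mul0r.
rewrite size_MXaddC; case: ifP => [/andP[/eqP-> /eqP->] _|_ pn].
  by rewrite mul0r add0r vrow0 mul0r.
rewrite vrowD vrowMX vrowC mulrDl exprS -mulrA (mulrA D) DJ mul1r IHn //.
by rewrite -scalerAl mulrA vacuum_J mul0r scaler0 addr0.
Qed.

(** Right multiplication by [J^n D^n] kills the first [n] entries of a row and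
    preserves the others. *)
Lemma vrow_take n p : vrow p * J ^+ n = 0 -> vrow p = vrow (take_poly n p).
Proof.
have vacXn q : vrow (q * 'X^n) = vrow q * D ^+ n.
  by rewrite vrowM rmorphXn /= horner_algX.
rewrite -{1 2}(poly_take_drop n p) vrowD vacXn mulrDl -(mulrA _ (D ^+ n)).
rewrite expD_expJ mulr1 vrow_expJ ?size_take_poly // add0r => ->.
by rewrite mul0r addr0.
Qed.

Lemma vacuum_skew_eval s : e0 * skew_eval s = vrow (map_poly (horner_eval 1) s).
Proof.
elim/poly_ind: s => [|s c IHs]; first by rewrite skew_eval0 mulr0 rmorph0 vrow0.
rewrite skew_evalD skew_evalMX skew_evalC mulrDr mulrA IHs vacuum_polyH.
by rewrite rmorphD rmorphM /= map_polyX map_polyC /= vrowD vrowMX vrowC.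
Qed.

Lemma finite_rank_expand k f : D ^+ k * f = 0 ->
  f = \sum_(i < k) J ^+ i * (e0 * (D ^+ i * f)).
Proof.
move=> kf; rewrite -[LHS]mul1r -[1](subrK (J ^+ k * D ^+ k)) mulrDl.
rewrite -(mulrA _ _ f) kf mulr0 addr0 sub1_expJ_expD mulr_suml.
by apply: eq_bigr => i _; rewrite !mulrA.
Qed.

Lemma finite_rank_expJ f : finite_rank f -> exists n, f * J ^+ n = 0.
Proof.
move=> [k kf]; have [q fq] := choice (fun i => vacuum_mul (D ^+ i * f)).
exists (\max_(i < k) size (q i)).
rewrite (finite_rank_expand kf) mulr_suml big1 // => i _.
rewrite fq -mulrA vrow_expJ ?mulr0 //.
exact: (leq_bigmax (F := fun i : 'I_k => size (q i))).
Qed.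

Lemma finite_rank_sub k x : finite_rank (x - J ^+ k * (D ^+ k * x)).
Proof.
by exists k; rewrite mulrBr (mulrA (D ^+ k)) expD_expJ mul1r subrr.
Qed.

(** * The part of a left ideal inside F *)

Section Ideals.
Variable I : set A.
Hypothesis lI : left_ideal I.

Lemma left_idealZ (c : K) x : I x -> I (c *: x).
Proof. by have [_ _ IM] := lI; rewrite -mulr_algl; apply: IM. Qed.

Lemma skew_ideal_skew_eval : skew_ideal [set s | I (skew_eval s)].
Proof.
have [I0 ID IM] := lI; split=> [|s Is]; last first.
  by rewrite /= -D_skew_eval; apply: IM.
split=> [|c s t Is It] /=; first by rewrite skew_eval0.
by rewrite skew_evalZD; apply: ID => //; apply: IM.
Qed.

Lemma linear_set_vrow : linear_set [set p | I (vrow p)].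
Proof.
have [I0 ID _] := lI; split=> [|c p q Ip Iq] /=; first by rewrite vrow0.
by rewrite vrowZD; apply: ID => //; apply: left_idealZ.
Qed.

(** An element of [F] is a left linear combination of its rows. *)
Lemma finite_rank_mem f : finite_rank f ->
  (forall n p, e0 * (D ^+ n * f) = vrow p -> I (vrow p)) -> I f.
Proof.
move=> [k kf] If; rewrite (finite_rank_expand kf).
apply: (left_ideal_sum (x := fun i => J ^+ i * (e0 * (D ^+ i * f)))) => // i _.
have [_ _ IM] := lI; apply: IM.
have [p fp] := vacuum_mul (D ^+ i * f); rewrite fp; exact: If fp.
Qed.

(** [J^n a] has its first [n] rows empty; they are filled with the [w i]. *)
Definition stack n a (w : nat -> {poly K}) : A :=
  J ^+ n * a + \sum_(i < n) J ^+ i * vrow (w i).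

Lemma expD_stack n a w : D ^+ n * stack n a w = a.
Proof.
rewrite mulrDr mulrA expD_expJ mul1r mulr_sumr big1 ?addr0 // => i _.
by rewrite /vrow !mulrA expD_expJ_vacuum // mul0r.
Qed.

Lemma vacuum_expD_stack n a w i : (i < n)%N ->
  e0 * (D ^+ i * stack n a w) = vrow (w i).
Proof.
move=> ltin; rewrite mulrA mulrDr mulrA vacuum_expD_expJ // mul0r add0r.
rewrite mulr_sumr (bigD1 (Ordinal ltin)) //= big1 ?addr0 => [|j /negPf ji].
  by rewrite -mulrA (mulrA _ (J ^+ i)) expD_expJ mul1r mulrA vacuum_idem.
have [lt_ij|lt_ji|eq_ij] := ltngtP i j.
- by rewrite mulrA vacuum_expD_expJ // mul0r.
- rewrite -!mulrA !(mulrA (J ^+ j)) !(mulrA (D ^+ i)) expD_expJ_vacuum //.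
  by rewrite mul0r mulr0.
- by move: ji; rewrite -val_eqE /= eq_ij eqxx.
Qed.

Lemma stack_mem n a w : I a -> (forall i, (i < n)%N -> I (vrow (w i))) ->
  I (stack n a w).
Proof.
move=> Ia Iw; have [_ ID IM] := lI; apply: ID; first exact: IM.
apply: (left_ideal_sum (x := fun i => J ^+ i * vrow (w i))) => // i ni.
by apply: IM; apply: Iw.
Qed.

Lemma mem_stack n a w : I (stack n a w) ->
  I a /\ forall i, (i < n)%N -> I (vrow (w i)).
Proof.
have [_ _ IM] := lI; move=> It; split=> [|i ni].
  by rewrite -(expD_stack n a w); apply: IM.
by rewrite -(vacuum_expD_stack a w ni); do 2!apply: (IM).
Qed.

End Ideals.

(** One element of [W] for each degree that occurs in [W]. *)
Lemma pivots (W : set {poly K}) : W 0 -> exists w : nat -> {poly K}, forall n,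
  W (w n) /\ forall p, W p -> size p = n.+1 -> size (w n) = n.+1.
Proof.
move=> W0.
have piv n : exists q,
    W q /\ forall p, W p -> size p = n.+1 -> size q = n.+1.
  have [[p Wp pn]|noW] := pselect (exists2 p, W p & size p = n.+1).
    by exists p.
  by exists 0; split=> // p Wp pn; case: noW; exists p.
by have [w Ww] := choice piv; exists w.
Qed.

(** Finitely many elements of [F] are killed on the right by a common [J^n], and
    then so is the left ideal [I] that they generate. Thus all rows of [I] have
    at most [n] entries and [n] pivots generate. *)
Lemma left_finite_rank_principal (I : set A) :
    left_ideal I -> left_ideal_fg I -> I `<=` finite_rank ->
  exists a, I = left_ideal_gen [set a].
Proof.
move=> lI [G finG defI] IF; have [I0 ID IM] := lI.
have [n In] : exists n, forall f, I f -> f * J ^+ n = 0.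
  have [gs defG] := (finite_seqP G).1 finG.
  have [n gn] : exists n, forall g, g \in gs -> g * J ^+ n = 0.
    have : forall g, g \in gs -> finite_rank g.
      move=> g gG; apply: IF; rewrite defI; apply: sub_gen_smallest.
      by rewrite defG.
    elim: gs {defG} => [|g gs IHgs] Fg; first by exists 0%N.
    have [h hgs|n gsn] := IHgs; first by apply: Fg; rewrite inE hgs orbT.
    have [m gm] := finite_rank_expJ (Fg g (mem_head _ _)).
    exists (m + n)%N => h; rewrite inE => /predU1P[->|hgs].
      by rewrite exprD mulrA gm mul0r.
    by rewrite addnC exprD mulrA gsn ?mul0r.
  exists n => f; rewrite defI => /(_ [set x | x * J ^+ n = 0]); apply.
  split=> [|g]; last by rewrite defG; apply: gn.
  split=> [|x y /= xn yn|c x /= xn]; rewrite /= ?mul0r //.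
    by rewrite mulrDl xn yn addr0.
  by rewrite -mulrA xn mulr0.
pose W : set {poly K} := [set p | I (vrow p) /\ (size p <= n)%N].
have Wl : linear_set W.
  have [V0 VD] := linear_set_vrow lI.
  split=> [|c p q [Ip pn] [Iq qn]]; first by split; rewrite ?size_poly0.
  split; first exact: VD.
  rewrite (leq_trans (size_polyD _ _)) // geq_max qn andbT.
  exact: leq_trans (size_scale_leq _ _) pn.
have [w Ww] := pivots Wl.1.
exists (stack n 0 w); apply: left_ideal_genE => //.
  move=> _ ->; apply: stack_mem => // i _; by case: (Ww i) => -[].
move=> T lT aT f If; have [_ Tw] := mem_stack lT (aT _ erefl).
apply: finite_rank_mem => // [|m p fp]; first exact: IF.
have Ip : I (vrow p) by rewrite -fp; do 2!apply: (IM).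
rewrite (vrow_take (In _ Ip)).
apply: (linear_set_sizes Wl (linear_set_vrow lT)); last first.
  by split; rewrite ?size_take_poly // -(vrow_take (In _ Ip)).
move=> q Wq q0; have sq : size q = (size q).-1.+1.
  by rewrite prednK // size_poly_gt0.
exists (w (size q).-1); have [Ww1 Ww2] := Ww (size q).-1.
split=> //; last by rewrite (Ww2 q) // -sq.
by apply: Tw; rewrite -sq; case: Wq.
Qed.

(** The leading entry of the row [e0 D^n s] is the leading coefficient of [s] at
    [n + 1], which is nonzero for large [n]. *)
Lemma size_vrow_expD s : [pchar K] =i pred0 -> s != 0 ->
  exists N, forall n, (N <= n)%N ->
    exists2 p, e0 * (D ^+ n * skew_eval s) = vrow p & size p = (n + size s)%N.
Proof.
move=> charK0 s0; have l0 : lead_coef s != 0 by rewrite lead_coef_eq0.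
have [N lN] := eventually_nonroot charK0 l0; exists N => n Nn.
exists (map_poly (horner_eval 1) (iter n (@skew_shift K) s)).
  by rewrite expD_skew_eval vacuum_skew_eval.
have [_ <- _] := iter_skew_shift n s0; apply: size_map_poly_id0.
rewrite lead_coef_iter_skew_shift /= /horner_eval horner_comp !hornerE.
by rewrite -mulrS lN // (leq_trans Nn).
Qed.

(** * Left ideals not contained in F *)

Section Torsion.
Variables I M : set A.
Hypotheses (lI : left_ideal I) (lM : left_ideal M).
Hypothesis FM : I `&` finite_rank `<=` M.

(** Modulo [F], the element [D] is invertible. *)
Lemma expD_mem T n x : left_ideal T -> M `<=` T -> I x -> T (D ^+ n * x) -> T x.
Proof.
move=> [_ TD TM] MT Ix Tx; have [_ _ IM] := lI.
rewrite -(subrK (J ^+ n * (D ^+ n * x)) x); apply: TD; last exact: TM.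
apply: MT; apply: FM; split; last exact: finite_rank_sub.
by apply: left_idealB => //; do 2!apply: (IM).
Qed.

Definition torsion x := exists2 p, p != 0 & M (horner_alg H p * x).

Hypothesis charK0 : [pchar K] =i pred0.

(** Take [z = x + D^i y] with [i] such that [p' = p(X - i)] is coprime to [q].
    Modulo [M], [p(H) z] is [p(H) D^i y = D^i p'(H) y], so a left ideal
    containing [z] and [M] contains both [D^i p'(H) y] and [D^i q(H) y]; by
    Bezout it contains [D^i y]. *)
Lemma torsion_merge x y : I x -> I y -> torsion x -> torsion y ->
  exists z, [/\ I z, torsion z &
    forall T, left_ideal T -> M `<=` T -> T z -> T x /\ T y].
Proof.
move=> Ix Iy [p p0 Mpx] [q q0 Mqy]; have [I0 ID IM] := lI.
have [i /Bezout_eq1_coprimepP[[u v] /= uv]] := coprime_shift charK0 p0 q0.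
set p' := p \Po _ in uv.
have pD : horner_alg H p * D ^+ i = D ^+ i * horner_alg H p'.
  rewrite expD_polyH /p' -comp_polyA comp_polyB comp_polyX comp_polyC.
  by rewrite addrK comp_polyXr.
exists (x + D ^+ i * y); split.
- by apply: ID => //; apply: IM.
- exists (p * (q \Po ('X + i%:R%:P))).
    rewrite mulf_neq0 // -size_poly_eq0 size_comp_poly2 ?size_poly_eq0 //.
    exact: size_XaddC.
  have [_ MD MM] := lM; rewrite mulrDr; apply: MD.
    by rewrite mulrC rmorphM -mulrA; apply: MM.
  rewrite rmorphM -mulrA (mulrA _ (D ^+ i)) -expD_polyH -mulrA.
  by do 2!apply: (MM).
move=> T lT MT Tz; have [_ TD TM] := lT.
have Ty : T y.
  apply: (expD_mem (n := i)) => //.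
  rewrite -[y]mul1r -(rmorph1 (horner_alg H)) -uv rmorphD !rmorphM.
  rewrite mulrDl mulrDr.
  apply: TD; last by rewrite -mulrA; do 2!apply: (TM); apply: MT.
  rewrite -mulrA mulrA expD_polyH -mulrA; apply: (TM).
  rewrite mulrA -pD -mulrA -[X in T X](addKr (horner_alg H p * x)).
  rewrite -mulrDr addrC.
  by apply: left_idealB => //; [apply: TM|apply: MT].
split=> //; rewrite -(addrK (D ^+ i * y) x).
by apply: left_idealB => //; apply: TM.
Qed.

Lemma torsion_fg (xs : seq A) : (forall x, x \in xs -> I x /\ torsion x) ->
  exists z, [/\ I z, torsion z &
    forall T, left_ideal T -> M `<=` T -> T z -> forall x, x \in xs -> T x].
Proof.
elim: xs => [|x xs IHxs] xsP.
  have [I0 _ _] := lI; have [M0 _ _] := lM.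
  exists 0; split=> //; exists 1; first exact: oner_neq0.
  by rewrite mulr0.
have [Ix tx] := xsP x (mem_head _ _).
have [y|y [Iy ty xsy]] := IHxs.
  by move=> yxs; apply: xsP; rewrite inE yxs orbT.
have [z [Iz tz xyz]] := torsion_merge Ix Iy tx ty.
exists z; split=> // T lT MT Tz t; have [Tx Ty] := xyz T lT MT Tz.
by rewrite inE => /predU1P[->//|]; apply: xsy.
Qed.

End Torsion.

(** One generator is the element [a] of least degree among the skew polynomials
    in [I], with the missing rows stacked onto it; the other merges all the
    elements that are torsion modulo [a]. *)
Lemma left_ideal_two_generated (I : set A) : [pchar K] =i pred0 ->
    left_ideal I -> ~ (I `<=` finite_rank) ->
  exists a b, I = left_ideal_gen [set a; b].
Proof.
move=> charK0 lI IF; have [I0 ID IM] := lI.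
have skL := skew_ideal_skew_eval lI; set L := (X in skew_ideal X) in skL.
have [s Ls s0] : exists2 s, L s & s != 0.
  apply: contrapT => noL; apply: IF => f If.
  have [k [s fs]] := expD_normal f; exists k; rewrite fs.
  have [->|s0] := eqVneq s 0; first exact: skew_eval0.
  by case: noL; exists s; rewrite // /L /= -fs; apply: IM.
have [a [La a0] mina] := @minimize _ [set s | L s /\ s != 0]
  (fun s => size s) s (conj Ls s0).
have [gs Lgs genL] := skew_ideal_fg skL.
(* Working modulo [M] amounts to working modulo [a] in the quotient by [F]. *)
pose M := left_ideal_gen ([set skew_eval a] `|` (I `&` finite_rank)).
have lM : left_ideal M by apply: left_ideal_gen_ideal.
have Ma : M (skew_eval a) by apply: sub_gen_smallest; left.
have FM : I `&` finite_rank `<=` M.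
  by move=> f If; apply: sub_gen_smallest; right.
have tors x : x \in map skew_eval gs -> I x /\ torsion M x.
  move=> /mapP[g /Lgs Lg ->]; split=> //.
  have mina' b : L b -> b != 0 -> (size a <= size b)%N.
    by move=> Lb b0; apply: mina.
  have skM := skew_ideal_skew_eval lM.
  have [p p0 Mp] := skew_ideal_torsion skL skM La Ma a0 mina' Lg.
  by exists p => //; rewrite -[_ * _]addr0 -skew_eval0 -skew_evalZD addr0.
have [b [Ib _ genb]] := torsion_fg lI lM FM charK0 tors.
have [N aN] := size_vrow_expD charK0 a0.
have Wl := linear_set_vrow lI; have [w Ww] := pivots Wl.1.
(* From size [n] on, every size is reached by a row of the ideal of [a]. *)
pose n := (N + size a)%N.
exists (stack n (skew_eval a) w), b; apply: left_ideal_genE => //.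
  move=> _ [->|->] //; apply: stack_mem => // i _; by case: (Ww i).
move=> T lT abT; have [T0 TD TM] := lT.
have Tb : T b by apply: abT; right.
have [Ta Tw] : T (skew_eval a) /\ forall i, (i < n)%N -> T (vrow (w i)).
  by apply: mem_stack => //; apply: abT; left.
have FT : I `&` finite_rank `<=` T.
  move=> f [If Ff]; apply: finite_rank_mem => // i p fp.
  apply: (linear_set_sizes Wl (linear_set_vrow lT)); last first.
    by rewrite /= -fp; do 2!apply: (IM).
  move=> q Wq q0; have sq : size q = (size q).-1.+1.
    by rewrite prednK // size_poly_gt0.
  have [ltqn|leqn] := ltnP (size q).-1 n.
    exists (w (size q).-1); have [Ww1 Ww2] := Ww (size q).-1.
    by split; [|apply: Tw|rewrite (Ww2 q) // -sq].
  have [|r ar sr] := aN (size q - size a)%N.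
    by rewrite -(addnK (size a) N) leq_sub2r // (leq_trans leqn) ?leq_pred.
  exists r; split; rewrite /= -?ar.
  - by do 2!apply: (IM).
  - by do 2!apply: (TM).
  - rewrite sr subnK // (leq_trans (leq_addl N _)) //.
    by rewrite (leq_trans leqn) ?leq_pred.
have MT : M `<=` T by apply: smallest_sub => // f [->|/FT].
have LT : L `<=` [set s | T (skew_eval s)].
  apply: genL => [|g ggs]; first exact: skew_ideal_skew_eval.
  by apply: (genb T lT MT Tb); apply: map_f.
move=> x Ix; have [k [t xt]] := expD_normal x.
apply: (expD_mem (n := k) lI FM lT MT Ix); rewrite xt; apply: LT.
by rewrite /L /= -xt; apply: IM.
Qed.

(** * Comparison with the span of the matrix units *)

Definition matrix_unit i j : A := J ^+ i * D ^+ j - J ^+ i.+1 * D ^+ j.+1.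

Lemma matrix_unitE i j : matrix_unit i j = J ^+ i * e0 * D ^+ j.
Proof. by rewrite /matrix_unit exprSr (exprS D) mulrBr mulr1 mulrBl !mulrA. Qed.

Lemma finite_rank_matrix f : finite_rank f <->
  exists n (c : 'M[K]_n),
    f = \sum_(i < n) \sum_(j < n) c i j *: matrix_unit i j.
Proof.
split=> [[k kf]|[n [c ->]]]; last first.
  exists n; rewrite mulr_sumr big1 // => i _; rewrite mulr_sumr big1 // => j _.
  by rewrite matrix_unitE -scalerAr !mulrA expD_expJ_vacuum // mul0r scaler0.
have [q fq] := choice (fun i => vacuum_mul (D ^+ i * f)).
have sum_q n i : (size (q i) <= n)%N ->
    J ^+ i * vrow (q i) = \sum_(j < n) (q i)`_j *: matrix_unit i j.
  move=> qn; rewrite -{1}(take_poly_id qn) /take_poly poly_def /vrow.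
  rewrite linear_sum /= !mulr_sumr; apply: eq_bigr => j _.
  rewrite linearZ /= rmorphXn /= horner_algX mulr_algl -!scalerAr.
  by rewrite matrix_unitE mulrA.
pose n := (k + \max_(i < k) size (q i))%N.
exists n, (\matrix_(i, j) if (i < k)%N then (q i)`_j else 0).
rewrite {1}(finite_rank_expand kf) (big_ord_widen n
  (fun i => J ^+ i * (e0 * (D ^+ i * f)))) ?leq_addr // big_mkcond.
apply: eq_bigr => i _; case: ifP => ik; last first.
  by rewrite big1 // => j _; rewrite mxE ik scale0r.
rewrite fq (sum_q n); first by apply: eq_bigr => j _; rewrite mxE ik.
rewrite (leq_trans _ (leq_addl k _)) //.
exact: (leq_bigmax (F := fun i : 'I_k => size (q i)) (Ordinal ik)).
Qed.

End NormalForms.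

(** * The opposite algebra *)

Section Opposite.

(** An alias of its own, rather than the converse ring [A^c]: the latter unfolds
    to [A], so that an algebra structure inferred on it has the product of [A]
    in the original order. *)
Definition opposite (A : Type) : Type := A.

Variables (K : fieldType) (A : algType K).
Local Notation Aop := (opposite A).
Implicit Types (a b : K) (x y : Aop).

HB.instance Definition _ := GRing.NzRing.copy Aop A^c.

Definition opposite_scale a x : Aop := a *: (x : A).

Fact opposite_scaleA a b x :
  opposite_scale a (opposite_scale b x) = opposite_scale (a * b) x.
Proof. exact: scalerA. Qed.
Fact opposite_scale1 : left_id 1 opposite_scale.
Proof. exact: scale1r. Qed.
Fact opposite_scaleDr : right_distributive opposite_scale +%R.
Proof. exact: scalerDr. Qed.
Fact opposite_scaleDl x : {morph opposite_scale^~ x : a b / a + b}.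
Proof. by move=> a b; apply: scalerDl. Qed.

HB.instance Definition _ := GRing.Zmodule_isLmodule.Build K Aop
  opposite_scaleA opposite_scale1 opposite_scaleDr opposite_scaleDl.

Fact opposite_scaleAl a x y : a *: (x * y) = (a *: x) * y.
Proof. exact: (@scalerAr K A). Qed.

HB.instance Definition _ := GRing.Lmodule_isLalgebra.Build K Aop
  opposite_scaleAl.

Fact opposite_scaleAr a x y : a *: (x * y) = x * (a *: y).
Proof. exact: (@scalerAl K A). Qed.

HB.instance Definition _ := GRing.Lalgebra_isAlgebra.Build K Aop
  opposite_scaleAr.

Lemma opposite_expr (x : A) n : (x : Aop) ^+ n = x ^+ n :> A.
Proof. exact: revrX. Qed.

Lemma opposite_integro_differential (J D H : A) :
  integro_differential J D H ->
  integro_differential (D : Aop) (J : Aop) (H : Aop).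
Proof.
move=> idA; have [DJ HJ DH e0H gen] := idA; split=> //.
- exact: H_vacuum idA.
- move=> B B1 Bl BM BD BJ BH x; apply: (gen B) => // y z By Bz.
  exact: BM Bz By.
Qed.

(** The two inclusions are [finite_rank_expJ] in the opposite algebra and in the
    algebra itself. *)
Lemma finite_rank_opposite (J D H : A) : integro_differential J D H ->
  finite_rank (J : Aop) = finite_rank D.
Proof.
move=> idA; have idop := opposite_integro_differential idA.
apply/seteqP; split=> f Ff.
  have [n fn] := finite_rank_expJ idop Ff; exists n.
  by rewrite -fn /= -[in LHS](opposite_expr D).
have [n fn] := finite_rank_expJ idA Ff; exists n.
by rewrite -[RHS]fn -[in RHS](opposite_expr J).
Qed.

End Opposite.

(** * The operators on polynomials *)

Section Operators.
Variable K : fieldType.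
Hypothesis charK0 : [pchar K] =i pred0.
Implicit Types p : {poly K}.
Local Notation J := (I1_J K).
Local Notation D := (I1_D K).

Definition I1_H : I1 K := D * I1_X K.

Lemma coef_integ p i : (integ p)`_i = if i is k.+1 then p`_k / k.+1%:R else 0.
Proof.
rewrite /integ coef_sum; case: i => [|k].
  by rewrite big1 // => j _; rewrite coefZ coefXn mulr0.
have [kp|pk] := ltnP k (size p); last first.
  rewrite nth_default // mul0r big1 // => j _; rewrite coefZ coefXn eqSS.
  by rewrite gtn_eqF ?mulr0 // (leq_trans (ltn_ord j)).
rewrite (bigD1 (Ordinal kp)) //= coefZ coefXn eqxx mulr1 big1 ?addr0 // => j jk.
rewrite coefZ coefXn eqSS; case: eqP => [kj|_]; last by rewrite mulr0.
by case/eqP: jk; apply: val_inj.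
Qed.

Lemma coefXM_deriv p i : ('X * p)^`()`_i = p`_i *+ i.+1.
Proof. by rewrite coef_deriv coefXM. Qed.

Let natS n : n.+1%:R != 0 :> K.
Proof. by rewrite (pcharf0P _).1. Qed.

Let mulrnK (x : K) n : x *+ n.+1 / n.+1%:R = x.
Proof. by rewrite -[x *+ _]mulr_natr mulfK. Qed.

Lemma I1_eq (f g : I1 K) : (forall p, I1val f p = I1val g p) -> f = g.
Proof. by move=> fg; apply: val_inj; apply: poly_endP. Qed.

Lemma I1_J_H : J * I1_H = I1_X K.
Proof.
apply: I1_eq => p; change (integ ('X * p)^`() = 'X * p); apply/polyP => -[|i].
  by rewrite coef_integ coefXM.
by rewrite coef_integ coefXM_deriv coefXM mulrnK.
Qed.

Lemma I1_integro_differential : integro_differential J D I1_H.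
Proof.
split.
- apply: I1_eq => p; change ((integ p)^`() = p); apply/polyP => i.
  by rewrite coef_deriv coef_integ -[_ *+ i.+1]mulr_natr divfK.
- apply: I1_eq => p.
  change (('X * integ p)^`() = integ (('X * p)^`() + p)); apply/polyP => i.
  rewrite coefXM_deriv !coef_integ; case: i => [|i]; first by rewrite mul0rn.
  rewrite coefD coefXM_deriv -mulrSr -!(mulr_natr (_ / _)) -(mulr_natr p`_i).
  by rewrite mulrAC.
- apply: I1_eq => p.
  change (('X * p)^`()^`() = ('X * p^`())^`() + p^`()).
  by rewrite derivM derivX mul1r derivD addrC.
- apply: I1_eq => p.
  change (('X * p)^`() - integ (('X * p)^`())^`() = p - integ p^`()).
  apply/polyP => i; rewrite !coefB !coef_integ; case: i => [|i].
    by rewrite coefXM_deriv mulr1n.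
  by rewrite !coef_deriv coefXM !mulrnK !subrr.
move=> B B1 Bl BM BJ BD BH.
have BX : B (I1_X K) by rewrite -I1_J_H; apply: BM.
case=> f If; have genf : I1_set K f by have := If; rewrite inE.
have [|y By fy] := genf [set g | exists2 y, B y & I1val y = g]; last first.
  by rewrite (_ : MkI1 _ = y) //; apply: val_inj.
split; last by move=> g [[->|->]|->]; [exists (I1_X K)|exists D|exists J].
split=> [|c g h|g h]; rewrite !inE.
- by exists 1.
- by move=> [y By <-] [z Bz <-]; exists (c *: y + z) => //; apply: Bl.
- by move=> [y By <-] [z Bz <-]; exists (y * z) => //; apply: BM.
Qed.

Lemma I1_F_finite_rank : I1_F K = finite_rank D.
Proof.
apply/seteqP; split=> f.
  by rewrite (finite_rank_matrix I1_integro_differential).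
by rewrite (finite_rank_matrix I1_integro_differential).
Qed.

End Operators.

Theorem theorem4p5 (K : fieldType) (charK0 : [pchar K] =i pred0) :
  ((forall I : set (I1 K), left_ideal I -> left_ideal_fg I ->
      exists a b : I1 K, I = left_ideal_gen [set a; b]) /\
   (forall I : set (I1 K), right_ideal I -> right_ideal_fg I ->
      exists a b : I1 K, I = right_ideal_gen [set a; b])) /\
  ((forall I : set (I1 K), left_ideal I ->
      (~ (I `<=` I1_F K) ->
         exists a b : I1 K, I = left_ideal_gen [set a; b]) /\
      (I `<=` I1_F K -> left_ideal_fg I ->
         exists a : I1 K, I = left_ideal_gen [set a])) /\
   (forall I : set (I1 K), right_ideal I ->
      (~ (I `<=` I1_F K) ->
         exists a b : I1 K, I = right_ideal_gen [set a; b]) /\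
      (I `<=` I1_F K -> right_ideal_fg I ->
         exists a : I1 K, I = right_ideal_gen [set a]))).
Proof.
have idI := I1_integro_differential charK0.
have idop := opposite_integro_differential idI.
have FopE := finite_rank_opposite idI.
rewrite (I1_F_finite_rank charK0).
have left2 I : left_ideal I -> ~ (I `<=` finite_rank (I1_D K)) ->
    exists a b : I1 K, I = left_ideal_gen [set a; b].
  by move=> lI IF; have := left_ideal_two_generated idI charK0 lI IF.
have left1 I : left_ideal I -> I `<=` finite_rank (I1_D K) -> left_ideal_fg I ->
    exists a : I1 K, I = left_ideal_gen [set a].
  by move=> lI IF fgI; have := left_finite_rank_principal idI lI fgI IF.
(* A right ideal is by conversion a left ideal of the opposite algebra. *)
have right2 I : right_ideal I -> ~ (I `<=` finite_rank (I1_D K)) ->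
    exists a b : I1 K, I = right_ideal_gen [set a; b].
  rewrite -FopE => rI IF.
  exact (@left_ideal_two_generated _ _ _ _ _ idop I charK0 rI IF).
have right1 I : right_ideal I -> I `<=` finite_rank (I1_D K) ->
    right_ideal_fg I -> exists a : I1 K, I = right_ideal_gen [set a].
  rewrite -FopE => rI IF fgI.
  exact (@left_finite_rank_principal _ _ _ _ _ idop I rI fgI IF).
split; split=> I idealI.
- move=> fgI; have [IF|IF] := pselect (I `<=` finite_rank (I1_D K)).
    by have [a ->] := left1 I idealI IF fgI; exists a, a; rewrite setUid.
  exact: left2.
- move=> fgI; have [IF|IF] := pselect (I `<=` finite_rank (I1_D K)).
    by have [a ->] := right1 I idealI IF fgI; exists a, a; rewrite setUid.
  exact: right2.
- by split; [apply: left2|apply: left1].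
- by split; [apply: right2|apply: right1].
Qed.
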